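(* Let $(A,\rightarrow,\rightsquigarrow,0,1)$ be a good pseudo-BCK algebra satisfying the Glivenko property and let $v$ be a very true operator on $A$. Define $\tilde{v}:\mathrm{Reg}(A)\to \mathrm{Reg}(A)$ by $\tilde{v}(x)=(v(x))^{-\sim}$. Then $\tilde{v}$ is a very true operator on $\mathrm{Reg}(A)$.
   Context: A pseudo-BCK algebra is a structure $(A,\leq,\rightarrow,\rightsquigarrow,1)$ where $\leq$ is a binary relation on $A$, $\rightarrow$ and $\rightsquigarrow$ are binary operations on $A$ and $1\in A$, such that for all $x,y,z\in A$: $x\rightarrow y\leq (y\rightarrow z)\rightsquigarrow (x\rightarrow z)$ and $x\rightsquigarrow y\leq (y\rightsquigarrow z)\rightarrow (x\rightsquigarrow z)$; $x\leq (x\rightarrow y)\rightsquigarrow y$ and $x\leq (x\rightsquigarrow y)\rightarrow y$; $x\leq x$; $x\leq 1$; if $x\leq y$ and $y\leq x$ then $x=y$; $x\leq y$ iff $x\rightarrow y=1$ iff $x\rightsquigarrow y=1$. It is bounded if there is an element $0\in A$ with $0\leq x$ for all $x\in A$; it is then written $(A,\rightarrow,\rightsquigarrow,0,1)$, and one sets $x^{-}:=x\rightarrow 0$, $x^{\sim}:=x\rightsquigarrow 0$, $x^{-\sim}:=(x^{-})^{\sim}$, $x^{\sim-}:=(x^{\sim})^{-}$. A bounded pseudo-BCK algebra $A$ is good if $x^{-\sim}=x^{\sim-}$ for all $x\in A$. A good pseudo-BCK algebra has the Glivenko property if $(x\rightarrow y)^{-\sim}=x\rightarrow y^{-\sim}$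 and $(x\rightsquigarrow y)^{-\sim}=x\rightsquigarrow y^{-\sim}$ for all $x,y\in A$. $\mathrm{Reg}(A)=\{x\in A\mid x^{-\sim}=x^{\sim-}=x\}$; under the Glivenko property it is a subalgebra $(\mathrm{Reg}(A),\rightarrow,\rightsquigarrow,0,1)$ of $A$, hence itself a bounded pseudo-BCK algebra. A very true operator on a pseudo-BCK algebra $A$ is a map $v:A\to A$ such that for all $x,y\in A$: $v(1)=1$; $v(x)\leq x$; $v(x)\leq v(v(x))$; $v(x\rightarrow y)\leq v(x)\rightarrow v(y)$ and $v(x\rightsquigarrow y)\leq v(x)\rightsquigarrow v(y)$. *)

(* Defs.v *)
From Stdlib Require Import ssreflect ProofIrrelevance.

Set Implicit Arguments.
Unset Strict Implicit.
Unset Printing Implicit Defensive.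

Record pseudoBCK : Type := PseudoBCK {
  carrier :> Type;
  le : carrier -> carrier -> Prop;
  imp : carrier -> carrier -> carrier;
  simp : carrier -> carrier -> carrier;
  top : carrier;
  imp_trans : forall x y z, le (imp x y) (simp (imp y z) (imp x z));
  simp_trans : forall x y z, le (simp x y) (imp (simp y z) (simp x z));
  imp_mp : forall x y, le x (simp (imp x y) y);
  simp_mp : forall x y, le x (imp (simp x y) y);
  le_refl : forall x, le x x;
  le_top : forall x, le x top;
  le_anti : forall x y, le x y -> le y x -> x = y;
  le_imp : forall x y, le x y <-> imp x y = top;
  le_simp : forall x y, le x y <-> simp x y = top
}.

Arguments top {p}.

Declare Scope bck_scope.
Delimit Scope bck_scope with bck.
Notation "x <= y" := (le x y) : bck_scope.
Notation "x --> y" := (imp x y)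
  (at level 55, right associativity) : bck_scope.
Notation "x ~~> y" := (simp x y)
  (at level 55, right associativity) : bck_scope.
Notation "1" := top : bck_scope.
Local Open Scope bck_scope.

Record boundedPseudoBCK : Type := BoundedPseudoBCK {
  base :> pseudoBCK;
  bot : base;
  bot_le : forall x : base, bot <= x
}.

Arguments bot {b}.
Notation "0" := bot : bck_scope.

(* [neg x], [sneg x], [neg_sneg x], [sneg_neg x] are written x^-, x^~,
   x^{-~} = (x^-)^~ and x^{~-} = (x^~)^- respectively. *)
Definition neg (A : boundedPseudoBCK) (x : A) : A := x --> 0.
Definition sneg (A : boundedPseudoBCK) (x : A) : A := x ~~> 0.
Definition neg_sneg (A : boundedPseudoBCK) (x : A) : A := sneg (neg x).
Definition sneg_neg (A : boundedPseudoBCK) (x : A) : A := neg (sneg x).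

Definition good (A : boundedPseudoBCK) : Prop :=
  forall x : A, neg_sneg x = sneg_neg x.

Definition glivenko (A : boundedPseudoBCK) : Prop :=
  forall x y : A,
    neg_sneg (x --> y) = x --> neg_sneg y /\
    neg_sneg (x ~~> y) = x ~~> neg_sneg y.

Definition very_true (A : pseudoBCK) (v : A -> A) : Prop :=
  v 1 = 1 /\
  (forall x, v x <= x) /\
  (forall x, v x <= v (v x)) /\
  (forall x y, v (x --> y) <= v x --> v y) /\
  (forall x y, v (x ~~> y) <= v x ~~> v y).

Definition is_regular (A : boundedPseudoBCK) (x : A) : Prop :=
  neg_sneg x = x /\ sneg_neg x = x.

Definition Reg (A : boundedPseudoBCK) : Type := {x : A | is_regular x}.

Lemma Reg_inj (A : boundedPseudoBCK) (x y : Reg A) :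
  proj1_sig x = proj1_sig y -> x = y.
Proof.
case: x y => [x hx] [y hy] /= e; case: y / e hy => hy.
by rewrite (proof_irrelevance _ hx hy).
Qed.

Section Basic.
Variable A : pseudoBCK.
Implicit Types x y z : A.

Lemma top_le x : 1 <= x -> x = 1.
Proof. by move=> h; apply: le_anti => //; apply: le_top. Qed.

Lemma imp_refl x : x --> x = 1.
Proof. by apply/le_imp; apply: le_refl. Qed.

Lemma simp_refl x : x ~~> x = 1.
Proof. by apply/le_simp; apply: le_refl. Qed.

Lemma top_imp x : 1 --> x = x.
Proof.
apply: le_anti.
  by apply/le_simp/top_le; apply: imp_mp.
by rewrite -{1}(simp_refl x); apply: simp_mp.
Qed.

Lemma top_simp x : 1 ~~> x = x.
Proof.
apply: le_anti.
  by apply/le_imp/top_le; apply: simp_mp.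
by rewrite -{1}(imp_refl x); apply: imp_mp.
Qed.

Lemma imp_anti x y z : x <= y -> y --> z <= x --> z.
Proof.
move=> /le_imp h; apply/le_simp/top_le; rewrite -h; exact: imp_trans.
Qed.

End Basic.

Section Regular.
Variable A : boundedPseudoBCK.
Implicit Types x y z : A.

Lemma neg_sneg_neg x : neg (neg_sneg x) = neg x.
Proof.
apply: le_anti; last exact: simp_mp.
by apply: imp_anti; apply: imp_mp.
Qed.

Lemma regular_top : is_regular (1 : A).
Proof.
rewrite /is_regular /neg_sneg /sneg_neg /neg /sneg.
by rewrite top_imp top_simp simp_refl imp_refl.
Qed.

Lemma regular_bot : is_regular (0 : A).
Proof.
rewrite /is_regular /neg_sneg /sneg_neg /neg /sneg.
by rewrite imp_refl simp_refl top_imp top_simp.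
Qed.

Hypothesis hgood : good A.

Lemma regular_neg_sneg x : is_regular (neg_sneg x).
Proof.
have h : neg_sneg (neg_sneg x) = neg_sneg x.
  by rewrite {1}/neg_sneg neg_sneg_neg.
by rewrite /is_regular -hgood.
Qed.

Hypothesis hgliv : glivenko A.

Lemma regular_imp x y : is_regular y -> is_regular (x --> y).
Proof.
by move=> [h _]; rewrite /is_regular -hgood (proj1 (hgliv _ _)) h.
Qed.

Lemma regular_simp x y : is_regular y -> is_regular (x ~~> y).
Proof.
by move=> [h _]; rewrite /is_regular -hgood (proj2 (hgliv _ _)) h.
Qed.

End Regular.

Section RegAlgebra.
Variables (A : boundedPseudoBCK) (hgood : good A) (hgliv : glivenko A).

Definition Reg_le (x y : Reg A) : Prop := proj1_sig x <= proj1_sig y.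

Definition Reg_imp (x y : Reg A) : Reg A :=
  exist _ (proj1_sig x --> proj1_sig y)
    (regular_imp hgood hgliv (proj1_sig x) (proj2_sig y)).

Definition Reg_simp (x y : Reg A) : Reg A :=
  exist _ (proj1_sig x ~~> proj1_sig y)
    (regular_simp hgood hgliv (proj1_sig x) (proj2_sig y)).

Definition Reg_top : Reg A := exist _ 1 (regular_top A).
Definition Reg_bot : Reg A := exist _ 0 (regular_bot A).

Lemma Reg_le_anti x y : Reg_le x y -> Reg_le y x -> x = y.
Proof. by move=> xy yx; apply: Reg_inj; apply: le_anti. Qed.

Lemma Reg_le_imp x y : Reg_le x y <-> Reg_imp x y = Reg_top.
Proof.
split=> [/le_imp h | /(f_equal (@proj1_sig _ _)) h]; first exact: Reg_inj.
exact/le_imp.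
Qed.

Lemma Reg_le_simp x y : Reg_le x y <-> Reg_simp x y = Reg_top.
Proof.
split=> [/le_simp h | /(f_equal (@proj1_sig _ _)) h]; first exact: Reg_inj.
exact/le_simp.
Qed.

Definition Reg_pseudoBCK : pseudoBCK :=
  @PseudoBCK (Reg A) Reg_le Reg_imp Reg_simp Reg_top
    (fun x y z => imp_trans (proj1_sig x) (proj1_sig y) (proj1_sig z))
    (fun x y z => simp_trans (proj1_sig x) (proj1_sig y) (proj1_sig z))
    (fun x y => imp_mp (proj1_sig x) (proj1_sig y))
    (fun x y => simp_mp (proj1_sig x) (proj1_sig y))
    (fun x => le_refl (proj1_sig x))
    (fun x => le_top (proj1_sig x))
    Reg_le_anti Reg_le_imp Reg_le_simp.

Definition Reg_bounded : boundedPseudoBCK :=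
  @BoundedPseudoBCK Reg_pseudoBCK Reg_bot (fun x => bot_le (proj1_sig x)).

End RegAlgebra.

Definition vtilde (A : boundedPseudoBCK) (hgood : good A) (v : A -> A)
    (x : Reg A) : Reg A :=
  exist _ (neg_sneg (v (proj1_sig x))) (regular_neg_sneg hgood _).

(* Main.v *)
From Stdlib Require Import ssreflect.
Require Import Defs.

Local Open Scope bck_scope.

(** Write [n] for the double negation [neg_sneg], a closure operator on [A],
and recall that a very true operator [v] is monotone.

The operator [x |-> n (v x)] takes [1] to [1], and lies below the identity on
regular elements because [n] is monotone and fixes them.  It lies below its
own square because [v x <= v (v x)] and [v x <= n (v x)] give
[v x <= v (n (v x))], to which [n] is applied.  For the implication, [n] is applied to
[v (x --> y) <= v x --> v y]; the Glivenko property turns the upper bound into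
[v x --> n (v y)].  It remains to replace [v x] by [n (v x)] there, which is
[imp_neg_sneg]: by the exchange law [imp_simp_exchange],
[a --> n b = neg b ~~> neg a], and the right-hand side depends on [a] only
through [neg a = neg (n a)].

The axioms are invariant under interchanging the two implications, so every
statement about [-->] yields its mirror image by passing to the opposite
algebra [op]; goodness identifies the two double negations, so the mirror image
of [neg_sneg_vt_imp] is the axiom for [~~>]. *)

(** * The opposite algebra *)

Definition op (A : pseudoBCK) : pseudoBCK :=
  @PseudoBCK A (@le A) (@simp A) (@imp A) top
    (@simp_trans A) (@imp_trans A) (@simp_mp A) (@imp_mp A)
    (@le_refl A) (@le_top A) (@le_anti A) (@le_simp A) (@le_imp A).

Definition op_bounded (A : boundedPseudoBCK) : boundedPseudoBCK :=
  @BoundedPseudoBCK (op A) (bot : A) (@bot_le A).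

Lemma good_op (A : boundedPseudoBCK) : good A -> good (op_bounded A).
Proof. by move=> h x; rewrite -[LHS](h x). Qed.

Lemma glivenko_op (A : boundedPseudoBCK) :
  good A -> glivenko A -> glivenko (op_bounded A).
Proof.
move=> hgood hgliv x y; have [hi hs] := hgliv x y.
by rewrite !hgood in hi hs; split.
Qed.

Lemma very_true_op (A : pseudoBCK) (v : A -> A) :
  very_true v -> @very_true (op A) v.
Proof. by move=> [h1 [h2 [h3 [h4 h5]]]]. Qed.

(** * Order and exchange *)

Section Exchange.
Variable A : pseudoBCK.
Implicit Types x y z : A.

Lemma le_trans x y z : x <= y -> y <= z -> x <= z.
Proof.
move=> xy /le_imp yz; apply/le_imp/top_le; rewrite -yz.
exact: imp_anti.
Qed.

Lemma simp_anti x y z : x <= y -> y ~~> z <= x ~~> z.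
Proof. exact: (@imp_anti (op A)). Qed.

Lemma imp_simp_exchange_le x y z : x --> (y ~~> z) <= y ~~> (x --> z).
Proof.
(* The middle term composes with [y ~~> z] and then weakens [y] to the larger
   element [(y ~~> z) --> z]. *)
apply: (@le_trans _ (((y ~~> z) --> z) ~~> (x --> z))).
  exact: imp_trans.
by apply: simp_anti; apply: simp_mp.
Qed.

End Exchange.

Lemma imp_simp_exchange (A : pseudoBCK) (x y z : A) :
  x --> (y ~~> z) = y ~~> (x --> z).
Proof.
apply: le_anti; first exact: imp_simp_exchange_le.
exact: (@imp_simp_exchange_le (op A)).
Qed.

(** * Double negation *)

Section DoubleNegation.
Variable A : boundedPseudoBCK.
Implicit Types x y : A.

Lemma le_neg_sneg x : x <= neg_sneg x.
Proof. exact: imp_mp. Qed.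

Lemma neg_sneg_mono x y : x <= y -> neg_sneg x <= neg_sneg y.
Proof. by move=> xy; apply: simp_anti; apply: imp_anti. Qed.

(** Exchange makes [x --> neg_sneg y] equal to [neg y ~~> neg x], so only the
negation of [x] matters, and [x] has the same negation as [neg_sneg x]. *)
Lemma imp_neg_sneg x y : neg_sneg x --> neg_sneg y = x --> neg_sneg y.
Proof.
by rewrite {2 3}/neg_sneg /sneg !imp_simp_exchange -!/(neg _) neg_sneg_neg.
Qed.

End DoubleNegation.

(** * Very true operators *)

(** Apply the axiom for [-->] to [x --> y = 1]. *)
Lemma very_true_mono (A : pseudoBCK) (v : A -> A) (x y : A) :
  very_true v -> x <= y -> v x <= v y.
Proof.
move=> [v1 [_ [_ [vi _]]]] /le_imp xy; apply/le_imp/top_le.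
by rewrite -{1}v1 -xy.
Qed.

Lemma neg_sneg_vt_imp (A : boundedPseudoBCK) (v : A -> A) (x y : A) :
  glivenko A -> very_true v ->
  neg_sneg (v (x --> y)) <= neg_sneg (v x) --> neg_sneg (v y).
Proof.
move=> hgliv [_ [_ [_ [vi _]]]].
rewrite imp_neg_sneg -(proj1 (hgliv _ _)).
exact/neg_sneg_mono/vi.
Qed.

Theorem proposition4p12 (A : boundedPseudoBCK) (hgood : good A)
  (hgliv : glivenko A) (v : A -> A) (hv : very_true v) :
  @very_true (Reg_bounded hgood hgliv) (vtilde hgood v).
Proof.
have [v1 [v_le [v_vv _]]] := hv.
split; last split; last split; last split.
- by apply: Reg_inj; rewrite /= v1; case: (regular_top A).
- move=> [x [nx hx]]; rewrite /= /Reg_le /= -[X in _ <= X]nx.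
  exact/neg_sneg_mono/v_le.
- move=> [x hx]; rewrite /= /Reg_le /=; apply: neg_sneg_mono.
  apply: le_trans (v_vv x) _.
  by apply: very_true_mono => //; apply: le_neg_sneg.
- by move=> [x hx] [y hy]; apply: neg_sneg_vt_imp.
- move=> [x hx] [y hy]; rewrite /= /Reg_le /= !hgood.
  apply: (@neg_sneg_vt_imp (op_bounded A)); first exact: glivenko_op.
  exact: very_true_op.
Qed.
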